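(* Let $p,q\in\mathbb{R}$, and assume that the matrix inequality $$\left(\frac{A^p+B^p}{2}\right)^{1/p}\le\left(\frac{A^q+B^q}{2}\right)^{1/q}$$ holds for every $A,B\in\mathbb{P}_2$. Then $(p,q)$ satisfies at least one of the following conditions: (i) $p=q$; (ii) $1\le p<q$; (iii) $p<q\le-1$; (iv) $p\le-1$ and $q\ge1$; (v) $1/2\le p<1\le q$; (vi) $p\le-1<q\le-1/2$.
   Context: $\mathbb{P}_n$ denotes the set of positive definite matrices in the algebra $\mathbb{M}_n$ of $n\times n$ complex matrices. For Hermitian matrices $X,Y$, $X\le Y$ means that $Y-X$ is positive semidefinite. Real powers, logarithms and exponentials of matrices are taken in the sense of functional calculus. Convention for exponent zero: when $p=0$, the expression $\left(\frac{A^p+B^p}{2}\right)^{1/p}$ means $\exp\left(\frac{\log A+\log B}{2}\right)$ (the limit as $p\to0$), and likewise for $q=0$. *)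

(* Defs.v *)
From HB Require Import structures.
From mathcomp Require Import all_boot all_order all_algebra.
From mathcomp Require Import complex.
From mathcomp Require Import all_classical all_reals all_analysis.

Set Implicit Arguments.
Unset Strict Implicit.
Unset Printing Implicit Defensive.

Import Order.TTheory GRing.Theory Num.Theory.
Local Open Scope ring_scope.
Local Open Scope sesquilinear_scope.
Local Open Scope complex_scope.

Section MatrixMeans.
Variables (R : realType) (n : nat).
Implicit Types (X Y A B : 'M[R[i]]_n) (f : R -> R) (p : R).

(* In the order of R[i], [0 <= z] and [0 < z] entail that z is real. *)
Definition posdefmx A : Prop :=
  A \is hermsymmx /\
  forall v : 'cV[R[i]]_n, v != 0 -> 0 < (v^t* *m A *m v) 0 0.

Definition possemidefmx A : Prop :=
  A \is hermsymmx /\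
  forall v : 'cV[R[i]]_n, 0 <= (v^t* *m A *m v) 0 0.

Definition loewner_le X Y : Prop := possemidefmx (Y - X).

(* Functional calculus f(A) = P^-1 diag(f(d)) P, where A = P^-1 diag(d) P is
   the library's unitary diagonalization. It is meaningful for Hermitian A,
   whose eigenvalues d are real; the value then does not depend on the choice
   of the diagonalization. *)
Definition mxfun f A : 'M[R[i]]_n :=
  invmx (spectralmx A)
    *m diag_mx (map_mx (fun z : R[i] => (f (complex.Re z))%:C) (spectral_diag A))
    *m spectralmx A.

Definition mxpowR A p : 'M[R[i]]_n := mxfun (fun x => powR x p) A.
Definition mxln A : 'M[R[i]]_n := mxfun (@ln R) A.
Definition mxexpR A : 'M[R[i]]_n := mxfun (@expR R) A.

Definition mxpower_mean p A B : 'M[R[i]]_n :=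
  if p == 0 then mxexpR (2^-1 *: (mxln A + mxln B))
  else mxpowR (2^-1 *: (mxpowR A p + mxpowR B p)) p^-1.

End MatrixMeans.

(* Main.v *)
Require Import Defs.
From mathcomp Require Import all_boot all_order all_algebra.
From mathcomp Require Import complex.
From mathcomp Require Import all_classical all_reals all_analysis.
From mathcomp Require Import ring lra.
Import Order.TTheory GRing.Theory Num.Theory.
Local Open Scope ring_scope.

(** With [f_p x = (x^p - 1) / p] (and [f_0 = ln]) the mean of order [p] is
    [f_p^-1 ((f_p A + f_p B) / 2)].  Take [A] and [B] with eigenvalues [1, a] and
    [1, b], where [a, b > 1], and eigenbases rotated so that [(f_q A + f_q B) / 2]
    is diagonal with a small eigenvalue [O(e^2)] on the first basis vector; the
    parameter [e] measures the rotation angles.  Comparing the first diagonal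
    entries of the two means as [e] tends to 0 yields, with [al, be] the values of
    [f_q] and [al', be'] those of [f_p] at [a, b],
      [(M_p(a, b) - 1) (al' be - be' al)^2
         <= 8 al be (al + be) (al' + be')^2].
    For [b = 2 a] and [a] large this forces [1 <= q]; for [a = 2] and [b] large
    it forces [p < 0] or [1/2 <= p].  The inequality for [(p, q)] implies the one for
    [(-q, -p)] by passing to inverses, which gives the remaining constraints. *)

Set Implicit Arguments.
Unset Strict Implicit.
Unset Printing Implicit Defensive.

(** * Functional calculus on real symmetric 2x2 matrices *)

Section RealSymmetric.
Variable R : realType.
Implicit Types a b c d s x y : R.
Local Open Scope complex_scope.
Local Open Scope sesquilinear_scope.

(* With W = P U, where P is the spectral matrix of A, the hypothesis says that W
   intertwines the two diagonal matrices, so W i j != 0 forces the eigenvalues to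
   agree. *)
Lemma mxfun_diag n (f : R -> R) (A : 'M[R[i]%C]_n) m (U : 'M[R[i]%C]_(n, m)) (d : 'rV[R]_m) :
  A \is hermsymmx ->
  A *m U = U *m diag_mx (map_mx (real_complex R) d) ->
  mxfun f A *m U = U *m diag_mx (map_mx (real_complex R) (map_mx f d)).
Proof.
move=> /hermitian_normalmx /orthomx_spectralP eA eU.
have Pu := spectral_unit A.
have eW : diag_mx (spectral_diag A) *m (spectralmx A *m U) =
          spectralmx A *m U *m diag_mx (map_mx (real_complex R) d).
  rewrite -[RHS]mulmxA -eU !mulmxA; congr (_ *m U).
  by have := congr1 (mulmx (spectralmx A)) eA; rewrite !mulmxA mulmxV // mul1mx.
rewrite /mxfun -!mulmxA; apply: (can_inj (mulKmx Pu)).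
rewrite mulKVmx // [RHS]mulmxA.
apply/matrixP => i j.
move/matrixP/(_ i j): eW; rewrite !mul_diag_mx !mul_mx_diag !mxE.
set w := \sum_k _; have [->|w0] := eqVneq w 0; first by rewrite !mulr0 !mul0r.
by rewrite mulrC => /(mulfI w0) ->; rewrite mulrC.
Qed.

Definition symmx a b d : 'M[R[i]%C]_2 :=
  \matrix_(i, j) (if i == j then if i == 0 then a else d else b)%:C.

Lemma symmxD a b d a' b' d' :
  symmx a b d + symmx a' b' d' = symmx (a + a') (b + b') (d + d').
Proof.
by apply/matrixP => i j; rewrite !mxE -rmorphD; case: (i == j); case: (i == 0).
Qed.

Lemma symmxZ k a b d : k%:C *: symmx a b d = symmx (k * a) (k * b) (k * d).
Proof.
by apply/matrixP => i j; rewrite !mxE -rmorphM; case: (i == j); case: (i == 0).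
Qed.

Lemma symmx_herm a b d : symmx a b d \is hermsymmx.
Proof.
apply: realsym_hermsym.
  apply/is_hermitianmxP; rewrite expr0 scale1r map_mx_id //.
  by apply/matrixP => i j; rewrite !mxE eq_sym; case: eqP => // ->.
by apply/mxOverP => i j; rewrite mxE complex_real.
Qed.

(* For c^2 + s^2 = 1, this has eigenvalue x on (c, -s) and y on (s, c). *)
Definition rotmx c s x y : 'M[R[i]%C]_2 :=
  symmx (x * c ^+ 2 + y * s ^+ 2) ((y - x) * s * c) (x * s ^+ 2 + y * c ^+ 2).

Definition rot c s : 'M[R[i]%C]_2 :=
  \matrix_(i, j) (if i == j then c else if i == 0 then s else - s)%:C.

Definition pair_rv x y : 'rV[R]_2 := \row_j (if j == 0 then x else y).

Lemma rot_unit c s : c ^+ 2 + s ^+ 2 = 1 -> rot c s \in unitmx.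
Proof.
move=> h; have h' : s ^+ 2 = 1 - c ^+ 2 by rewrite -h; ring.
have [|//]  := @mulmx1_unit _ _ (rot c s) (rot c (- s)).
apply/matrixP => i j; rewrite !mxE !big_ord_recl big_ord0 !mxE.
by case: i => [[|[|//]] ?]; case: j => [[|[|//]] ?];
  apply/eqP; rewrite eq_complex /=; apply/andP; split; apply/eqP; ring: h'.
Qed.

Lemma rotmxE c s x y : c ^+ 2 + s ^+ 2 = 1 ->
  rotmx c s x y *m rot c s =
  rot c s *m diag_mx (map_mx (real_complex R) (pair_rv x y)).
Proof.
move=> h; have h' : s ^+ 2 = 1 - c ^+ 2 by rewrite -h; ring.
apply/matrixP => i j; rewrite mul_mx_diag !mxE !big_ord_recl big_ord0 !mxE.
case: i => [[|[|//]] ?]; case: j => [[|[|//]] ?] /=;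
  apply/eqP; rewrite eq_complex /=; apply/andP; split; apply/eqP; ring: h'.
Qed.

Lemma mxfun_rotmx f c s x y : c ^+ 2 + s ^+ 2 = 1 ->
  mxfun f (rotmx c s x y) = rotmx c s (f x) (f y).
Proof.
move=> h; apply: (can_inj (@mulmxK _ 2 2 _ (rot_unit h))).
rewrite (mxfun_diag f (symmx_herm _ _ _) (rotmxE x y h)) rotmxE //.
congr (_ *m diag_mx _); apply/matrixP => i j; rewrite !mxE.
by case: (j == 0).
Qed.

Lemma symmx_form a b d u v :
  let w : 'cV[R[i]%C]_2 := \col_j (if j == 0 then u else v)%:C in
  (w^t* *m symmx a b d *m w) 0 0 =
  (a * u ^+ 2 + b * u * v *+ 2 + d * v ^+ 2)%:C.
Proof.
rewrite /= !mxE !big_ord_recl big_ord0 !mxE !big_ord_recl !big_ord0 !mxE /=.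
apply/eqP; rewrite eq_complex /=; apply/andP; split; apply/eqP; ring.
Qed.

Lemma possemidefmx_symmx a b d u v : possemidefmx (symmx a b d) ->
  0 <= a * u ^+ 2 + b * u * v *+ 2 + d * v ^+ 2.
Proof.
case=> _ /(_ (\col_j (if j == 0 then u else v)%:C)).
by rewrite symmx_form ler0c.
Qed.

(** In the rotated basis the form is x |p|^2 + y |q|^2, and the coordinates p, q vanish together
    only for v = 0 because the rotation is invertible. *)
Lemma posdefmx_rotmx c s x y : c ^+ 2 + s ^+ 2 = 1 -> 0 < x -> 0 < y ->
  posdefmx (rotmx c s x y).
Proof.
move=> h x0 y0; split=> [|v v0]; first exact: symmx_herm.
set a := v 0 0; set b := v 1 0.
have -> : (v^t* *m rotmx c s x y *m v) 0 0 =
  x%:C * `|c%:C * a - s%:C * b| ^+ 2 + y%:C * `|s%:C * a + c%:C * b| ^+ 2.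
  rewrite !mxE !big_ord_recl big_ord0 !mxE !big_ord_recl !big_ord0 !mxE /=.
  rewrite !normCK; have -> : lift ord0 ord0 = 1 :> 'I_2 by apply/val_inj.
  rewrite -/a -/b; case: a b => [a1 a2] [b1 b2].
  by apply/eqP; rewrite eq_complex /=; apply/andP; split; apply/eqP; ring.
set p := c%:C * a - s%:C * b; set q := s%:C * a + c%:C * b.
have [p0|p0] := eqVneq p 0; last first.
  apply: ltr_wpDr; first by rewrite mulr_ge0 ?exprn_ge0 // ler0c ltW.
  by rewrite mulr_gt0 ?ltcR // exprn_gt0 // normr_gt0.
rewrite p0 normr0 expr0n mulr0 add0r mulr_gt0 ?ltcR // exprn_gt0 // normr_gt0.
apply: contraNneq v0 => q0.
have h1 : c%:C ^+ 2 + s%:C ^+ 2 = 1 by rewrite -!rmorphXn -rmorphD /= h.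
have a0 : a = c%:C * p + s%:C * q by rewrite -[LHS]mul1r -h1 /p /q; ring.
have b0 : b = c%:C * q - s%:C * p by rewrite -[LHS]mul1r -h1 /p /q; ring.
move: a0 b0; rewrite p0 q0 !mulr0 addr0 subr0 => a0 b0.
apply/eqP/matrixP => i j; rewrite mxE ord1.
by case: i => [[|[|//]] hi]; [rewrite -[RHS]a0 | rewrite -[RHS]b0];
  congr (v _ _); apply/val_inj.
Qed.

End RealSymmetric.

(** * Power means of matrices sharing an eigenvalue *)

Section Means.
Variable R : realType.
Implicit Types a b c d s t x y p q : R.
Local Open Scope complex_scope.

Lemma symmx_midpoint a b d a' b' d' :
  2^-1 *: (symmx a b d + symmx a' b' d') =
  symmx ((a + a') / 2) ((b + b') / 2) ((d + d') / 2).
Proof.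
have e : 2^-1 = (2^-1)%:C :> R[i] by rewrite fmorphV rmorph_nat.
by rewrite symmxD e symmxZ; congr symmx; rewrite mulrC.
Qed.

Lemma loewner_rotmx c s x y c' s' x' y' u v :
  loewner_le (rotmx c s x y) (rotmx c' s' x' y') ->
  x * (c * u - s * v) ^+ 2 + y * (s * u + c * v) ^+ 2 <=
  x' * (c' * u - s' * v) ^+ 2 + y' * (s' * u + c' * v) ^+ 2.
Proof.
have -> : rotmx c' s' x' y' = rotmx c s x y +
    symmx (x' * c' ^+ 2 + y' * s' ^+ 2 - (x * c ^+ 2 + y * s ^+ 2))
      ((y' - x') * s' * c' - (y - x) * s * c)
      (x' * s' ^+ 2 + y' * c' ^+ 2 - (x * s ^+ 2 + y * c ^+ 2)).
  by rewrite symmxD; congr symmx; ring.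
rewrite /loewner_le addrC addKr => /(possemidefmx_symmx u v).
by rewrite -[in X in _ -> X]subr_ge0 => h; apply: le_trans h _; rewrite le_eqVlt; apply/orP; left; apply/eqP; ring.
Qed.

(** An affine change of x^p, completed by its limit at p = 0. It yields the same mean, sends 1 to 0
    and is increasing whatever the sign of p. *)
Definition boxcox p x := if p == 0 then ln x else (x `^ p - 1) / p.

(** This inverts [boxcox p] only where [0 < 1 + p * t], whence the side conditions carried below. *)
Definition invboxcox p t := if p == 0 then expR t else (1 + p * t) `^ p^-1.

Lemma boxcoxN p x : 0 < x -> boxcox (- p) x = - boxcox p x^-1.
Proof.
move=> x0; rewrite /boxcox oppr_eq0; case: eqP => _.
  by rewrite lnV // opprK.
by rewrite invrN mulrN -(powR_inv1 (ltW x0)) -powRrM mulN1r.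
Qed.

Lemma invboxcoxN p t : invboxcox (- p) t = (invboxcox p (- t))^-1.
Proof.
rewrite /invboxcox oppr_eq0; case: eqP => _; first by rewrite -expRN opprK.
by rewrite invrN powRN mulrN mulNr.
Qed.

(* Entrywise form of (f_p A + f_p B) / 2 = rotmx c s t u, where f_p = boxcox p,
   A = rotmx c1 s1 1 a and B = rotmx c2 s2 1 b (recall f_p 1 = 0). *)
Definition mean_spectrum p c1 s1 c2 s2 a b c s t u :=
  [/\ (boxcox p a * s1 ^+ 2 + boxcox p b * s2 ^+ 2) / 2 =
        t * c ^+ 2 + u * s ^+ 2,
      (boxcox p a * s1 * c1 + boxcox p b * s2 * c2) / 2 = (u - t) * s * c &
      (boxcox p a * c1 ^+ 2 + boxcox p b * c2 ^+ 2) / 2 =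
        t * s ^+ 2 + u * c ^+ 2].

(** For p != 0, x^p = 1 + p f_p(x), so the midpoint of the p-th powers is
    [rotmx c s (1 + p * t) (1 + p * u)]; for p = 0 the midpoint of the logarithms is [rotmx c s t u]
    itself. *)
Lemma power_mean_rotmx p c1 s1 c2 s2 a b c s t u :
  c1 ^+ 2 + s1 ^+ 2 = 1 -> c2 ^+ 2 + s2 ^+ 2 = 1 -> c ^+ 2 + s ^+ 2 = 1 ->
  mean_spectrum p c1 s1 c2 s2 a b c s t u ->
  mxpower_mean p (rotmx c1 s1 1 a) (rotmx c2 s2 1 b) =
  rotmx c s (invboxcox p t) (invboxcox p u).
Proof.
move=> h1 h2 h; rewrite /mean_spectrum /mxpower_mean /boxcox /invboxcox.
case: eqP => [p0|/eqP p0] [e1 e2 e3].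
  rewrite /mxln /mxexpR !mxfun_rotmx // ln1 symmx_midpoint.
  rewrite -(mxfun_rotmx (@expR R) t u h).
  by congr mxfun; congr symmx; rewrite -?e1 -?e2 -?e3; ring.
rewrite /mxpowR !mxfun_rotmx // symmx_midpoint powR1.
rewrite -(mxfun_rotmx (fun x => x `^ p^-1) (1 + p * t) (1 + p * u) h).
have h' : s ^+ 2 = 1 - c ^+ 2 by rewrite -h; ring.
have h1' : s1 ^+ 2 = 1 - c1 ^+ 2 by rewrite -h1; ring.
have h2' : s2 ^+ 2 = 1 - c2 ^+ 2 by rewrite -h2; ring.
congr mxfun; congr symmx.
- transitivity (1 + p * (t * c ^+ 2 + u * s ^+ 2)); last by ring: h'.
  by rewrite -e1 h1' h2'; field.
- transitivity (p * ((u - t) * s * c)); last by ring.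
  by rewrite -e2; field.
- transitivity (1 + p * (t * s ^+ 2 + u * c ^+ 2)); last by ring: h'.
  by rewrite -e3 h1' h2'; field.
Qed.

(* The (0, 0) entries of the two means are compared for pairs A, B whose mean of
   order q is diagonal. *)
Definition dominated p q := forall c1 s1 c2 s2 a b c s tq uq tp up,
  c1 ^+ 2 + s1 ^+ 2 = 1 -> c2 ^+ 2 + s2 ^+ 2 = 1 -> c ^+ 2 + s ^+ 2 = 1 ->
  0 < a -> 0 < b ->
  mean_spectrum q c1 s1 c2 s2 a b 1 0 tq uq ->
  mean_spectrum p c1 s1 c2 s2 a b c s tp up ->
  0 < 1 + q * tq -> 0 < 1 + q * uq -> 0 < 1 + p * tp -> 0 < 1 + p * up ->
  invboxcox p tp * c ^+ 2 + invboxcox p up * s ^+ 2 <= invboxcox q tq.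

Definition mean_le p q := forall A B : 'M[R[i]]_2, posdefmx A -> posdefmx B ->
  loewner_le (mxpower_mean p A B) (mxpower_mean q A B).

Lemma mean_le_dominated p q : mean_le p q -> dominated p q.
Proof.
move=> H c1 s1 c2 s2 a b c s tq uq tp up h1 h2 h a0 b0 eq ep _ _ _ _.
have h10 : (1 : R) ^+ 2 + 0 ^+ 2 = 1 by ring.
have := H _ _ (posdefmx_rotmx h1 ltr01 a0) (posdefmx_rotmx h2 ltr01 b0).
rewrite (power_mean_rotmx h1 h2 h10 eq) (power_mean_rotmx h1 h2 h ep).
by move/(loewner_rotmx 1 0); rewrite !(mulr0, mulr1, subr0, addr0, expr0n, expr1n).
Qed.

Lemma mean_spectrumN p c1 s1 c2 s2 a b c s t u : 0 < a -> 0 < b ->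
  mean_spectrum (- p) c1 s1 c2 s2 a b c s t u ->
  mean_spectrum p c1 s1 c2 s2 a^-1 b^-1 c s (- t) (- u).
Proof.
move=> a0 b0; rewrite /mean_spectrum !boxcoxN // => -[e1 e2 e3].
split.
- by transitivity (- (t * c ^+ 2 + u * s ^+ 2)); [rewrite -e1 | ]; ring.
- by transitivity (- ((u - t) * s * c)); [rewrite -e2 | ]; ring.
- by transitivity (- (t * s ^+ 2 + u * c ^+ 2)); [rewrite -e3 | ]; ring.
Qed.

Lemma invboxcox_gt0 p t : 0 < 1 + p * t -> 0 < invboxcox p t.
Proof. by rewrite /invboxcox; case: eqP => _ h; rewrite ?expR_gt0 ?powR_gt0. Qed.

(** The mean of order -p is the inverse of the mean of order p of A^-1 and B^-1. Antitonicity of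
    inversion is checked by hand on the (0, 0) entry: evaluating diag(x^-1, y^-1) <= Z^-1 at Z e_0
    gives n^2 / x <= n, with n the (0, 0) entry of Z, hence n <= x. *)
Lemma mean_le_dominatedN p q : mean_le p q -> dominated (- q) (- p).
Proof.
move=> H c1 s1 c2 s2 a b c s tq uq tp up h1 h2 h a0 b0 eq ep + + + +.
have h10 : (1 : R) ^+ 2 + 0 ^+ 2 = 1 by ring.
move=> /invboxcox_gt0 x0 /invboxcox_gt0 y0 /invboxcox_gt0 z0 /invboxcox_gt0 w0.
have [a0' b0'] : 0 < a^-1 /\ 0 < b^-1 by rewrite !invr_gt0.
have := H _ _ (posdefmx_rotmx h1 ltr01 a0') (posdefmx_rotmx h2 ltr01 b0').
rewrite (power_mean_rotmx h1 h2 h10 (mean_spectrumN a0 b0 eq)).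
rewrite (power_mean_rotmx h1 h2 h (mean_spectrumN a0 b0 ep)).
rewrite -(invrK (invboxcox p _)) -(invrK (invboxcox p (- uq))).
rewrite -(invrK (invboxcox q _)) -(invrK (invboxcox q (- up))).
rewrite -!invboxcoxN.
move: x0 y0 z0 w0.
set x := invboxcox _ tq; set y := invboxcox _ uq.
set z := invboxcox _ tp; set w := invboxcox _ up => x0 y0 z0 w0.
set n := z * c ^+ 2 + w * s ^+ 2.
(* The test vector is the first column of the inverse of rotmx c s z^-1 w^-1. *)
move/(loewner_rotmx n ((w - z) * s * c)).
have h' : s ^+ 2 = 1 - c ^+ 2 by rewrite -h; ring.
have -> : c * n - s * ((w - z) * s * c) = z * c by rewrite /n; ring: h'.
have -> : s * n + c * ((w - z) * s * c) = w * s.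
  by rewrite /n -[RHS]mulr1 -[in RHS]h; ring.
have -> : z^-1 * (z * c) ^+ 2 + w^-1 * (w * s) ^+ 2 = n.
  by rewrite /n; field; rewrite !gt_eqF.
rewrite !mul1r !mul0r subr0 add0r => le_n.
have n_gt0 : 0 < n.
  rewrite /n h' -subr_ge0 in le_n *; nra.
have : x^-1 * n ^+ 2 <= n.
  apply: le_trans le_n; rewrite lerDl mulr_ge0 ?sqr_ge0 // invr_ge0 ltW //.
by rewrite expr2 mulrA ger_pMl // mulrC ler_pdivrMr // mul1r.
Qed.
End Means.

(** * The Box-Cox transform and plane rotations *)

Section BoxCox.
Variable R : realType.
Implicit Types a b c d r s t w x y p q : R.

Lemma powR_expR x p : 0 < x -> x `^ p = expR (p * ln x).
Proof. by move=> x0; rewrite /powR gt_eqF. Qed.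

Lemma boxcox_affine p x : 0 < x -> 1 + p * boxcox p x = x `^ p.
Proof.
move=> x0; rewrite /boxcox; case: eqP => [->|/eqP p0].
  by rewrite powRr0 mul0r addr0.
by field.
Qed.

Lemma boxcox1 p : boxcox p 1 = 0.
Proof. by rewrite /boxcox ln1 powR1 subrr mul0r if_same. Qed.

Lemma boxcoxK p x : 0 < x -> invboxcox p (boxcox p x) = x.
Proof.
move=> x0; have := boxcox_affine p x0; rewrite /invboxcox /boxcox.
case: eqP => [_ _|/eqP p0 ->]; first by rewrite lnK.
by rewrite -powRrM mulfV // powRr1 // ltW.
Qed.

Lemma invboxcoxK p t : 0 < 1 + p * t -> boxcox p (invboxcox p t) = t.
Proof.
rewrite /invboxcox /boxcox; case: eqP => [_ _|/eqP p0 h]; first exact: expRK.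
rewrite -powRrM mulVf // powRr1; last exact: ltW.
by field.
Qed.

Lemma boxcox_mono p : {in Num.pos &, {mono boxcox p : x y / x <= y}}.
Proof.
apply: le_mono_in => x y; rewrite !posrE => x0 y0 xy.
have lxy : ln x < ln y by rewrite ltr_ln.
rewrite /boxcox; case: (ltgtP p 0) => p0 //.
- rewrite ltr_nM2r ?invr_lt0 // ltrD2r !powR_expR // ltr_expR.
  by rewrite ltr_nM2l.
- rewrite ltr_pM2r ?invr_gt0 // ltrD2r !powR_expR // ltr_expR.
  by rewrite ltr_pM2l.
Qed.

Lemma boxcox_ltW p x y : 0 < x -> x < y -> boxcox p x < boxcox p y.
Proof.
by move=> x0 xy; rewrite (leW_mono_in (boxcox_mono p)) // posrE (lt_trans x0).
Qed.

Lemma boxcox_gt0 p x : 1 < x -> 0 < boxcox p x.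
Proof. by move=> x1; rewrite -(boxcox1 p) boxcox_ltW. Qed.

Lemma invboxcox_le p s t : 0 < 1 + p * s -> 0 < 1 + p * t -> s <= t ->
  invboxcox p s <= invboxcox p t.
Proof.
move=> hs ht; rewrite -[in X in X -> _](invboxcoxK hs) -[in X in X -> _](invboxcoxK ht).
move: (invboxcox_gt0 hs) (invboxcox_gt0 ht).
by move: (invboxcox p s) (invboxcox p t) => x y x0 y0; rewrite boxcox_mono.
Qed.

Lemma invboxcox0 p : invboxcox p 0 = 1.
Proof. by rewrite -(boxcox1 p) boxcoxK. Qed.

(** Chain (1 + q t)^(1/q) <= e^t <= 1 / (1 - t) <= 1 + 2 t, the last step using t <= 1/2. *)
Lemma invboxcox_ub q t : 0 < q -> 0 <= t <= 2^-1 -> invboxcox q t <= 1 + 2 * t.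
Proof.
move=> q0 /andP[t0 t2]; rewrite /invboxcox gt_eqF //.
have qt : 0 <= q * t by rewrite mulr_ge0 // ltW.
have h : 0 < 1 + q * t by lra.
apply: (@le_trans _ _ (expR t)).
  by rewrite powR_expR // ler_expR mulrC ler_pdivrMr // mulrC le_ln1Dx //; lra.
have : 1 - t <= (expR t)^-1 by rewrite -expRN expR_ge1Dx.
have e0 := expR_gt0 t.
rewrite -(ler_pM2r e0) mulVf ?gt_eqF // => h1.
nra.
Qed.

Lemma expR_strict_convex r w : 0 < r < 1 -> w != 0 ->
  expR (r * w) < r * expR w + (1 - r).
Proof.
move=> /andP[r0 r1] w0.
have e0 := expR_gt0 (r * w).
(* Average of the strict tangent inequalities at r * w. *)
have h1 : expR (r * w) * (1 + (1 - r) * w) < expR w.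
  have -> : expR w = expR (r * w) * expR ((1 - r) * w).
    by rewrite -expRD; congr expR; ring.
  by rewrite ltr_pM2l // expR_gt1Dx // mulf_neq0 // subr_eq0 gt_eqF.
have h2 : expR (r * w) * (1 - r * w) < 1.
  rewrite -[ltRHS](expRxMexpNx_1 (r * w)).
  by rewrite ltr_pM2l // expR_gt1Dx // oppr_eq0 mulf_neq0 // gt_eqF.
have h3 : r * (expR (r * w) * (1 + (1 - r) * w)) < r * expR w by rewrite ltr_pM2l.
have h4 : (1 - r) * (expR (r * w) * (1 - r * w)) < (1 - r) * 1.
  by rewrite ltr_pM2l // subr_gt0.
lra.
Qed.

(** The value ln x at exponent 0 separates negative from positive exponents. For two exponents of
    the same sign, strict convexity of exp applies with r the ratio of the smaller to the larger
    absolute value. *)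
Lemma boxcox_lt_exponent p q x : p < q -> 0 < x -> x != 1 ->
  boxcox p x < boxcox q x.
Proof.
move=> pq x0 x1; have u0 : ln x != 0 by rewrite ln_eq0.
have pos r : 0 < r -> ln x < boxcox r x.
  move=> r0; rewrite /boxcox gt_eqF // powR_expR // ltr_pdivlMr //.
  by rewrite mulrC ltrBrDl expR_gt1Dx // mulf_neq0 // gt_eqF.
have neg r : r < 0 -> boxcox r x < ln x.
  move=> r0; rewrite /boxcox lt_eqF // powR_expR // ltr_ndivrMr //.
  by rewrite mulrC ltrBrDl expR_gt1Dx // mulf_neq0 // lt_eqF.
have zer : boxcox 0 x = ln x by rewrite /boxcox eqxx.
have [p0|p0|p0] := ltgtP p 0.
- have [q0|q0|q0] := ltgtP q 0; last by rewrite q0 zer neg.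
  + rewrite /boxcox !lt_eqF // !powR_expR //.
    have r01 : 0 < q / p < 1.
      by rewrite ltr_ndivlMr // mul0r q0 ltr_ndivrMr // mul1r.
    have := expR_strict_convex r01 (mulf_neq0 (ltr0_neq0 p0) u0).
    have -> : q / p * (p * ln x) = q * ln x by field; rewrite lt_eqF.
    move=> h; rewrite ltr_ndivlMr //; move: h.
    have -> : (expR (p * ln x) - 1) / p * q = q / p * (expR (p * ln x) - 1) by ring.
    lra.
  + exact: lt_trans (neg _ p0) (pos _ q0).
- have q0 : 0 < q by exact: lt_trans pq.
  rewrite /boxcox !gt_eqF // !powR_expR //.
  have r01 : 0 < p / q < 1.
    by rewrite divr_gt0 // ltr_pdivrMr // mul1r.
  have := expR_strict_convex r01 (mulf_neq0 (lt0r_neq0 q0) u0).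
  have -> : p / q * (q * ln x) = p * ln x by field; rewrite gt_eqF.
  move=> h; rewrite ltr_pdivrMr //; move: h.
  have -> : (expR (q * ln x) - 1) / q * p = p / q * (expR (q * ln x) - 1) by ring.
  lra.
- by rewrite p0 zer pos // -p0.
Qed.

(* c and s are the cosine and sine of half the angle arcsin x. *)
Lemma double_angle x : `|x| <= 1 -> exists c s,
  [/\ c ^+ 2 + s ^+ 2 = 1, s * c *+ 2 = x,
      c ^+ 2 - s ^+ 2 = Num.sqrt (1 - x ^+ 2), x ^+ 2 / 4 <= s ^+ 2 &
      s ^+ 2 <= x ^+ 2 / 2].
Proof.
rewrite ler_norml => /andP[x1 x2].
have a0 : 0 <= 1 + x by lra.
have b0 : 0 <= 1 - x by lra.
have ea := sqr_sqrtr a0; have eb := sqr_sqrtr b0.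
have ha := sqrtr_ge0 (1 + x); have hb := sqrtr_ge0 (1 - x).
have -> : 1 - x ^+ 2 = (1 + x) * (1 - x) by ring.
rewrite sqrtrM //.
set a := Num.sqrt (1 + x) in ea ha *; set b := Num.sqrt (1 - x) in eb hb *.
(* Solves c + s = sqrt(1 + x), c - s = sqrt(1 - x), as (c + s)^2 = 1 + x and (c - s)^2 = 1 - x. *)
exists ((a + b) / 2), ((a - b) / 2).
have h1 : ((a + b) / 2) ^+ 2 + ((a - b) / 2) ^+ 2 = 1.
  by transitivity ((a ^+ 2 + b ^+ 2) / 2); [field | rewrite ea eb; field].
have h2 : (a - b) / 2 * ((a + b) / 2) *+ 2 = x.
  by transitivity ((a ^+ 2 - b ^+ 2) / 2); [field | rewrite ea eb; field].
have h3 : ((a + b) / 2) ^+ 2 - ((a - b) / 2) ^+ 2 = a * b by field.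
(* Hence 1/2 <= c^2 <= 1, and x^2 = 4 s^2 c^2 lies between 2 s^2 and 4 s^2. *)
have h4 : 0 <= a * b by exact: mulr_ge0.
split => //; rewrite -[in X in is_true X]h2;
  move: h1 h3; set c := (a + b) / 2; set s := (a - b) / 2 => h1 h3;
  have s2 := sqr_ge0 s; have c2 := sqr_ge0 c;
  have -> : (s * c *+ 2) ^+ 2 = 4 * s ^+ 2 * c ^+ 2 by ring.
- nra.
- nra.
Qed.

(** The eigenvalues are (a + d)/2 -+ r, and twice the rotation angle has sine b/r and cosine h/r.
    The last bound says that a large off-diagonal entry forces a large rotation; it follows from
    (b/r)^2 <= 4 s^2 and r <= d. *)
Lemma rotmx_spectrum a b d : 0 <= a -> a <= d -> b ^+ 2 <= a * d ->
  exists c s t u, [/\ c ^+ 2 + s ^+ 2 = 1,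
    [/\ a = t * c ^+ 2 + u * s ^+ 2, b = (u - t) * s * c &
        d = t * s ^+ 2 + u * c ^+ 2],
    0 <= t, d <= u & b ^+ 2 <= 4 * d ^+ 2 * s ^+ 2].
Proof.
move=> a0 ad bad.
have d0 : 0 <= d by exact: le_trans ad.
set h := (d - a) / 2; set r := Num.sqrt (h ^+ 2 + b ^+ 2).
have er : r ^+ 2 = h ^+ 2 + b ^+ 2 by rewrite sqr_sqrtr // addr_ge0 ?sqr_ge0.
have r0 : 0 <= r by exact: sqrtr_ge0.
have h0 : 0 <= h by rewrite /h; lra.
have hr : h <= r by rewrite -(ler_pXn2r (n := 2)) ?nnegrE // er lerDl sqr_ge0.
(* The determinant condition enters here and makes the smaller eigenvalue nonnegative. *)
have rm : r <= (a + d) / 2.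
  rewrite -(ler_pXn2r (n := 2)) ?nnegrE // ?er /h //; first nra.
  by rewrite divr_ge0 // addr_ge0.
have [rz|rn] := eqVneq r 0.
  have hz : h = 0 by apply/le_anti; rewrite h0 -rz hr.
  have bz : b ^+ 2 = 0 by move: er; rewrite rz hz expr0n /= add0r => <-.
  have da : d = a by move: hz; rewrite /h; lra.
  exists 1, 0, a, a; split => //.
  - by ring.
  - split; first by ring.
    + by rewrite subrr !mul0r; apply/eqP; rewrite -sqrf_eq0 bz.
    + by rewrite da; ring.
  - by rewrite da.
  - by rewrite bz expr0n /= mulr0.
have rp : 0 < r by rewrite lt_neqAle eq_sym rn.
have br : (b / r) ^+ 2 = 1 - (h / r) ^+ 2.
  transitivity ((r ^+ 2 - h ^+ 2) / r ^+ 2); last by field.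
  have -> : r ^+ 2 - h ^+ 2 = b ^+ 2 by rewrite er; ring.
  by field.
have b1 : `|b / r| <= 1.
  rewrite -[leLHS]ger0_norm // -(ler_pXn2r (n := 2)) ?nnegrE //.
  by rewrite ger0_norm // real_normK ?num_real // br expr1n gerBl sqr_ge0.
have [c [s [e1 e2 e3 e4 _]]] := double_angle b1.
have e3' : c ^+ 2 - s ^+ 2 = h / r.
  by rewrite e3 br opprB addrC subrK sqrtr_sqr ger0_norm // divr_ge0.
have hr' : h = (c ^+ 2 - s ^+ 2) * r by rewrite e3' mulfVK.
have br' : b = (s * c *+ 2) * r by rewrite e2 mulfVK.
have c2 : c ^+ 2 = 1 - s ^+ 2 by rewrite -e1; ring.
have ed : d - a = (1 - 2 * s ^+ 2) * r * 2.
  transitivity (h * 2); first by rewrite /h; field.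
  by rewrite hr' c2; ring.
exists c, s, ((a + d) / 2 - r), ((a + d) / 2 + r); split => //.
- split.
  + by rewrite c2; lra.
  + by rewrite br'; ring.
  + by rewrite c2; lra.
- lra.
- by move: hr; rewrite /h; lra.
- have : b ^+ 2 = 4 * (b / r) ^+ 2 / 4 * r ^+ 2 by field.
  have rd : r ^+ 2 <= d ^+ 2 by rewrite ler_pXn2r ?nnegrE //; lra.
  have := sqr_ge0 s; move: e4; set w := (b / r) ^+ 2 => e4 s0 ->.
  have : 0 <= w by exact: sqr_ge0.
  have := sqr_ge0 r.
  nra.
Qed.

End BoxCox.

(** * Restrictions on the exponents *)

Section Exponents.
Variable R : realType.
Implicit Types a b c d r s t w x y p q : R.

(** Diagonal matrices diag(a, 1), diag(b, 1) with f_p a = t and f_p b = -t have the identity as mean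
    of order p. If q < p, then f_q < f_p at a and b, so the scalar mean of order q falls below 1. *)
Lemma dominated_scalar p q : dominated p q -> p <= q.
Proof.
move=> dom; rewrite leNgt; apply/negP => qp.
(* Small enough that t and -t both lie in the range of f_p. *)
set t := (2 * (1 + `|p|))^-1.
have t0 : 0 < t by rewrite invr_gt0 mulr_gt0 // ltr_pwDl.
have pt : `|p * t| < 1.
  rewrite normrM (gtr0_norm t0) /t ltr_pdivrMr; last by rewrite mulr_gt0 // ltr_pwDl.
  have := normr_ge0 p; lra.
have [h1 h2] : 0 < 1 + p * t /\ 0 < 1 + p * - t.
  by move: pt; rewrite ltr_norml mulrN => /andP[]; lra.
have a0 := invboxcox_gt0 h1; have b0 := invboxcox_gt0 h2.
have ea := invboxcoxK h1; have eb := invboxcoxK h2.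
set a := invboxcox p t in a0 ea; set b := invboxcox p (- t) in b0 eb.
clearbody a b; clear h1 h2 pt; clearbody t.
have ne u : boxcox p u != 0 -> u != 1.
  by apply: contraNneq => ->; rewrite boxcox1.
have la : boxcox q a < t by rewrite -ea boxcox_lt_exponent // ne // ea gt_eqF.
have lb : boxcox q b < - t.
  by rewrite -eb boxcox_lt_exponent // ne // eb oppr_eq0 gt_eqF.
set m := (boxcox q a + boxcox q b) / 2.
have m0 : m < 0 by rewrite pmulr_llt0 ?invr_gt0 // -(subrr t) ltrD.
have qm : 0 < 1 + q * m.
  have -> : 1 + q * m = ((1 + q * boxcox q a) + (1 + q * boxcox q b)) / 2.
    by rewrite /m; move: (boxcox q a) (boxcox q b) => x y; field.
  by rewrite !boxcox_affine // divr_gt0 // addr_gt0 // powR_gt0.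
have e01 : (0 : R) ^+ 2 + 1 ^+ 2 = 1 by ring.
have e10 : (1 : R) ^+ 2 + 0 ^+ 2 = 1 by ring.
have sq : mean_spectrum q 0 1 0 1 a b 1 0 m 0 by split; rewrite /m; move: (boxcox q a) (boxcox q b) => x y; field.
have sp : mean_spectrum p 0 1 0 1 a b 1 0 0 0 by split; rewrite ea eb; field.
have [p10 q10] : 0 < 1 + p * 0 /\ 0 < 1 + q * 0 by rewrite !mulr0 addr0.
have := dom _ _ _ _ _ _ _ _ _ _ _ _ e01 e01 e10 a0 b0 sq sp qm q10 p10 p10.
rewrite invboxcox0 expr1n expr0n /= mulr0 mulr1 addr0 => le1.
have : boxcox q 1 <= boxcox q (invboxcox q m).
  by rewrite (boxcox_mono q) // ?posrE ?ltr01 ?invboxcox_gt0.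
by rewrite boxcox1 invboxcoxK // leNgt m0.
Qed.

(** Taking d strictly below f_p(M_p(a, b)) replaces the limit by one small rotation: the larger
    eigenvalue u of the order p side only has to stay above d. *)
Lemma dominated_bound p q a b d :
  dominated p q -> 0 < q -> 1 < a -> 1 < b ->
  let al := boxcox q a in let be := boxcox q b in
  let al' := boxcox p a in let be' := boxcox p b in
  0 <= d < (al' + be') / 2 ->
  (invboxcox p d - 1) * (al' * be - be' * al) ^+ 2 <=
  8 * al * be * (al + be) * (al' + be') ^+ 2.
Proof.
move=> dom q0 a1 b1 al be al' be' /andP[d0 dm].
have a0 := lt_trans ltr01 a1; have b0 := lt_trans ltr01 b1.
have al0 : 0 < al by exact: boxcox_gt0.
have be0 : 0 < be by exact: boxcox_gt0.
have al'0 : 0 < al' by exact: boxcox_gt0.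
have be'0 : 0 < be' by exact: boxcox_gt0.
have [qal qbe] : boxcox q a = al /\ boxcox q b = be by [].
have [pal' pbe'] : boxcox p a = al' /\ boxcox p b = be' by [].
clearbody al be al' be'.
set m := (al' + be') / 2 in dm.
have m0 : 0 < m by rewrite /m; lra.
(* The bound 1 keeps the sines below at most 1, the third condition ensures tq <= 1/2 for
   [invboxcox_ub], and the last one gives d <= D <= u. *)
have [e [e0 e1 em ed]] : exists e, [/\ 0 < e, e <= 1, e * (al + be) <= 1 &
    d <= m * (1 - e)].
  have s0 : 0 < al + be by rewrite addr_gt0.
  exists (Num.min 1 (Num.min (al + be)^-1 (1 - d / m))); split.
  - by rewrite !lt_min ltr01 invr_gt0 s0 subr_gt0 ltr_pdivrMr // mul1r.
  - by rewrite ge_min lexx.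
  - rewrite -ler_pdivlMr // mul1r ge_min; apply/orP; right.
    by rewrite ge_min lexx.
  - rewrite mulrC -ler_pdivrMr // lerBrDr addrC -lerBrDr.
    by rewrite ge_min; apply/orP; right; rewrite ge_min lexx orbT.
set k := e / (al + be).
have s0 : 0 < al + be by rewrite addr_gt0.
have k0 : 0 < k by rewrite divr_gt0.
have ks : k * (al + be) = e by rewrite mulfVK // gt_eqF.
have kal : 0 < k * al by rewrite mulr_gt0.
have kbe : 0 < k * be by rewrite mulr_gt0.
(* The doubled angles have sines k be and -k al, so that the off-diagonal entry al s1 c1 + be s2 c2
   of the order q side cancels. *)
have [c1 [s1 [h1 x1 _ _ u1]]] : exists c s, [/\ c ^+ 2 + s ^+ 2 = 1,
    s * c *+ 2 = k * be, c ^+ 2 - s ^+ 2 = Num.sqrt (1 - (k * be) ^+ 2),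
    (k * be) ^+ 2 / 4 <= s ^+ 2 & s ^+ 2 <= (k * be) ^+ 2 / 2].
  by apply: double_angle; rewrite gtr0_norm //; lra.
have [c2 [s2 [h2 x2 _ _ u2]]] : exists c s, [/\ c ^+ 2 + s ^+ 2 = 1,
    s * c *+ 2 = - (k * al),
    c ^+ 2 - s ^+ 2 = Num.sqrt (1 - (- (k * al)) ^+ 2),
    (- (k * al)) ^+ 2 / 4 <= s ^+ 2 & s ^+ 2 <= (- (k * al)) ^+ 2 / 2].
  by apply: double_angle; rewrite normrN gtr0_norm //; lra.
rewrite sqrrN in u2.
have x1' : s1 * c1 = k * be / 2 by rewrite -x1 mulr2n; field.
have x2' : s2 * c2 = - (k * al) / 2 by rewrite -x2 mulr2n; field.
have s1_ge0 := sqr_ge0 s1; have s2_ge0 := sqr_ge0 s2.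
have v1 : s1 ^+ 2 <= e / 2 by nra.
have v2 : s2 ^+ 2 <= e / 2 by nra.
have c1E : c1 ^+ 2 = 1 - s1 ^+ 2 by rewrite -h1; ring.
have c2E : c2 ^+ 2 = 1 - s2 ^+ 2 by rewrite -h2; ring.
set tq := (al * s1 ^+ 2 + be * s2 ^+ 2) / 2.
set uq := (al * c1 ^+ 2 + be * c2 ^+ 2) / 2.
have sq : mean_spectrum q c1 s1 c2 s2 a b 1 0 tq uq.
  split; rewrite qal qbe /tq /uq; [by field | | by field].
  by rewrite -[al * s1 * c1]mulrA -[be * s2 * c2]mulrA x1' x2'; field.
set A := (al' * s1 ^+ 2 + be' * s2 ^+ 2) / 2.
set B := (al' * s1 * c1 + be' * s2 * c2) / 2.
set D := (al' * c1 ^+ 2 + be' * c2 ^+ 2) / 2.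
have A0 : 0 <= A.
  by rewrite divr_ge0 // addr_ge0 // mulr_ge0 ?sqr_ge0 // ltW.
have AD : A <= D by rewrite /A /D c1E c2E; nra.
have BAD : B ^+ 2 <= A * D.
  rewrite -subr_ge0.
  have -> : A * D - B ^+ 2 = al' * be' * (s1 * c2 - s2 * c1) ^+ 2 / 4.
    by rewrite /A /B /D; field.
  by rewrite divr_ge0 // mulr_ge0 ?sqr_ge0 // mulr_ge0 // ltW.
have [c [s [t [u [h [eA eB eD] t0 Du Bs]]]]] := rotmx_spectrum A0 AD BAD.
have sp : mean_spectrum p c1 s1 c2 s2 a b c s t u by rewrite /mean_spectrum pal' pbe'; split.
have tum : t + u = m.
  have -> : t + u = A + D.
    by rewrite eA eD -[LHS]mulr1 -[in LHS]h; ring.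
  by rewrite /A /D /m c1E c2E; field.
have dD : d <= D by apply: le_trans ed _; rewrite /m /D c1E c2E; nra.
have pm : 0 < 1 + p * m.
  have -> : 1 + p * m = ((1 + p * al') + (1 + p * be')) / 2.
    by rewrite /m; field.
  by rewrite -pal' -pbe' !boxcox_affine // divr_gt0 // addr_gt0 // powR_gt0.
have pos x : 0 <= x -> x <= m -> 0 < 1 + p * x.
  move=> x0 xm; have [p0|p0] := leP 0 p; first by rewrite ltr_pwDl // mulr_ge0.
  by apply: lt_le_trans pm _; rewrite lerD2l ler_nM2l.
have u_ge0 : 0 <= u by lra.
have tq0 : 0 <= tq by rewrite divr_ge0 // addr_ge0 // mulr_ge0 ?sqr_ge0 // ltW.
have uq0 : 0 <= uq by rewrite divr_ge0 // addr_ge0 // mulr_ge0 ?sqr_ge0 // ltW.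
have tqb : tq <= k ^+ 2 * (al * be * (al + be)) / 4.
  have h3 : al * s1 ^+ 2 <= al * ((k * be) ^+ 2 / 2) by rewrite ler_pM2l.
  have h4 : be * s2 ^+ 2 <= be * ((k * al) ^+ 2 / 2) by rewrite ler_pM2l.
  rewrite /tq.
  have -> : k ^+ 2 * (al * be * (al + be)) / 4 =
    (al * ((k * be) ^+ 2 / 2) + be * ((k * al) ^+ 2 / 2)) / 2 by field.
  lra.
have tqh : tq <= 2^-1.
  rewrite /tq; nra.
have := dom _ _ _ _ _ _ _ _ _ _ _ _ h1 h2 h a0 b0 sq sp.
have qpos x : 0 <= x -> 0 < 1 + q * x.
  by move=> x0; rewrite ltr_pwDl // mulr_ge0 // ltW.
move=> /(_ (qpos _ tq0) (qpos _ uq0) (pos t t0 _) (pos u u_ge0 _)).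
move=> /(_ ltac:(lra) ltac:(lra)) hdom.
have ub : invboxcox q tq <= 1 + 2 * tq by rewrite invboxcox_ub // tq0 tqh.
have z1 : 1 <= invboxcox p t.
  rewrite -(invboxcox0 p); apply: invboxcox_le => //.
  - by rewrite mulr0 addr0.
  - by apply: pos => //; lra.
have w1 : invboxcox p d <= invboxcox p u.
  apply: invboxcox_le; [apply: pos => //; lra | apply: pos => //; lra | lra].
have d1 : 1 <= invboxcox p d.
  rewrite -(invboxcox0 p); apply: invboxcox_le => //.
  - by rewrite mulr0 addr0.
  - by apply: pos => //; lra.
move: w1 d1; move: (invboxcox p d) => W w1 d1.
(* Bounding the two eigenvalues of the order p mean below by 1 and W turns [hdom] into 1 + (W - 1)
   s^2 <= 1 + 2 tq. *)
have key : (W - 1) * s ^+ 2 <= 2 * tq.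
  have c2' : c ^+ 2 = 1 - s ^+ 2 by rewrite -h; ring.
  have := sqr_ge0 s; have := sqr_ge0 c.
  nra.
have BE : B = k * (al' * be - be' * al) / 4.
  by rewrite /B -[al' * s1 * c1]mulrA -[be' * s2 * c2]mulrA x1' x2'; field.
have Dm : D <= m by lra.
have D0 : 0 <= D by exact: le_trans AD.
have Bm : B ^+ 2 <= (al' + be') ^+ 2 * s ^+ 2.
  apply: le_trans Bs _; rewrite ler_wpM2r ?sqr_ge0 //.
  have -> : (al' + be') ^+ 2 = 4 * m ^+ 2 by rewrite /m; field.
  by rewrite ler_pM2l // ler_pXn2r ?nnegrE // ltW.
have k2 : 0 < k ^+ 2 / 16 by rewrite divr_gt0 // exprn_gt0.
(* B^2 and the bound on tq are both proportional to k^2, so the size of the rotation drops out. *)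
rewrite -(ler_pM2r k2).
have -> : (W - 1) * (al' * be - be' * al) ^+ 2 * (k ^+ 2 / 16) =
  (W - 1) * B ^+ 2 by rewrite BE; field.
apply: le_trans (_ : (W - 1) * ((al' + be') ^+ 2 * s ^+ 2) <= _).
  by rewrite ler_wpM2l // subr_ge0.
have -> : (W - 1) * ((al' + be') ^+ 2 * s ^+ 2) =
  (al' + be') ^+ 2 * ((W - 1) * s ^+ 2) by ring.
have -> : 8 * al * be * (al + be) * (al' + be') ^+ 2 * (k ^+ 2 / 16) =
  (al' + be') ^+ 2 * (2 * (k ^+ 2 * (al * be * (al + be)) / 4)) by field.
rewrite ler_wpM2l ?sqr_ge0 //; lra.
Qed.
End Exponents.

(** * Large eigenvalues: growth of f_p and the resulting bounds on p and q *)

Section Asymptotics.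
Variable R : realType.
Implicit Types a b c d k m r s t w x y p q : R.
Local Open Scope classical_set_scope.

Lemma near_powR_ge r m : 0 < r -> \forall x \near +oo, m <= x `^ r.
Proof.
move=> r0; near=> x.
have m1 : 1 <= Num.max m 1 by rewrite le_max lexx orbT.
apply: (@le_trans _ _ (Num.max m 1)); first by rewrite le_max lexx.
have x1 : (Num.max m 1) `^ r^-1 <= x by [].
have := @ge0_ler_powR _ r (ltW r0) ((Num.max m 1) `^ r^-1) x.
rewrite -powRrM mulVf ?gt_eqF // powRr1; last exact: le_trans m1.
by apply; rewrite ?nnegrE ?powR_ge0 //; apply: le_trans x1; rewrite powR_ge0.
Unshelve. all: by end_near. Qed.

Lemma boxcoxM p x y : 0 < x -> 0 < y ->
  boxcox p (x * y) = boxcox p x + x `^ p * boxcox p y.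
Proof.
move=> x0 y0; rewrite /boxcox; case: eqP => [->|/eqP p0].
  by rewrite powRr0 mul1r lnM.
by rewrite powRM ?ltW //; field.
Qed.

(** Doubling x multiplies f_q by about 2^q but f_p by about 2^max(p, 0), which is smaller; k is
    halfway between. This keeps al' be - be' al of order al al' when b = 2 a. *)
Lemma boxcox_doubling p q : p < q -> 0 < q ->
  exists k, [/\ 0 < k, k < 2 `^ q &
    \forall x \near +oo, boxcox p (2 * x) <= k * boxcox p x].
Proof.
move=> pq q0.
have two1 : (1 : R) < 2 by lra.
have ln2 : 0 < ln (2 : R) by exact: ln_gt0.
have mono r s : r < s -> 2 `^ r < 2 `^ s :> R.
  by move=> rs; rewrite !powR_expR // ltr_expR ltr_pM2r.
have kp := boxcox_gt0 p two1.
have [p0|p0] := leP 0 p.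
  have t0 : 0 < 2 `^ p :> R by exact: powR_gt0.
  have := mono _ _ pq; set k := (2 `^ p + 2 `^ q) / 2 => lt2.
  exists k; split; [by rewrite /k; lra | by rewrite /k; lra |].
  near=> x.
  have x0 : 0 < x by [].
  have x1 : 1 < x by [].
  rewrite boxcoxM //.
  have kp' : 0 < k - 2 `^ p by rewrite /k; lra.
  suff : boxcox p 2 <= (k - 2 `^ p) * boxcox p x by lra.
  rewrite mulrC -ler_pdivrMr //.
  apply: (@le_trans _ _ (ln x)).
    by rewrite -(expRK (boxcox p 2 / (k - 2 `^ p))) ler_ln ?posrE ?expR_gt0.
  have e : ln x = boxcox 0 x by rewrite /boxcox eqxx.
  move: p0; rewrite le_eqVlt => /predU1P[<-|p0]; first by rewrite e.
  by rewrite e ltW // boxcox_lt_exponent // gt_eqF.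
have h : 1 < 2 `^ q :> R by have := mono _ _ q0; rewrite powRr0.
set k := (1 + 2 `^ q) / 2.
exists k; split; [by rewrite /k; lra | by rewrite /k; lra |].
near=> x.
have x0 : 0 < x by [].
have x2 : 2 <= x by [].
(* Expanded as x * 2, so that the constant f_p 2 gets the factor x^p, which tends to 0 as p < 0. *)
rewrite mulrC boxcoxM //.
have k1 : 0 < k - 1 by rewrite /k; lra.
have le2 : boxcox p 2 <= boxcox p x by rewrite boxcox_mono ?posrE.
have xp : x `^ p <= k - 1.
  rewrite -[p]opprK powRN -[leRHS]invrK lef_pV2 ?posrE ?powR_gt0 ?invr_gt0 //.
  by near: x; apply: near_powR_ge; rewrite oppr_gt0.
have xp0 : 0 < x `^ p by exact: powR_gt0.
move: kp le2; move: (boxcox p 2) (boxcox p x) => u v; nra.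
Unshelve. all: by end_near. Qed.

(** Apply [dominated_bound] to a = x, b = 2 x, d = f_p(x/2). The left side is at least of order x
    al^2 al'^2 and the right side at most of order al^3 al'^2, so x = O(al) = O(x^q), impossible for
    q < 1. *)
Lemma dominated_ge1 p q : dominated p q -> p < q -> 0 < q -> 1 <= q.
Proof.
move=> dom pq q0; rewrite leNgt; apply/negP => q1.
have [k [k0 kT knear]] := boxcox_doubling pq q0.
set T := 2 `^ q in kT.
set C := 8 * (T + 1) * (T + 2) * (1 + k) ^+ 2.
near (pinfty_nbhs R) => x.
have x4 : 4 <= x by [].
have x0 : 0 < x by lra.
have hk : boxcox p (2 * x) <= k * boxcox p x by near: x.
have hM : 4 * C / q / (T - k) ^+ 2 + 1 <= x `^ (1 - q).
  by near: x; apply: near_powR_ge; rewrite subr_gt0.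
have [x1 x2 xh] : [/\ 1 < x, 1 < 2 * x & 1 < x / 2] by split; lra.
have al0 := boxcox_gt0 q x1; have al'0 := boxcox_gt0 p x1.
have be'0 := boxcox_gt0 p x2; have h0 := boxcox_gt0 p xh.
have beE : boxcox q (2 * x) = boxcox q 2 + T * boxcox q x by exact: boxcoxM.
have two1 : (1 : R) < 2 by lra.
have kq := boxcox_gt0 q two1.
have kql : boxcox q 2 <= boxcox q x by rewrite boxcox_mono ?posrE //; lra.
have l1 : boxcox p (x / 2) < boxcox p x by apply: boxcox_ltW; lra.
have l2 : boxcox p x < boxcox p (2 * x) by apply: boxcox_ltW; lra.
have hd : 0 <= boxcox p (x / 2) < (boxcox p x + boxcox p (2 * x)) / 2.
  move: l1 l2 h0.
  move: (boxcox p x) (boxcox p (x / 2)) (boxcox p (2 * x)) => u v w.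
  by lra.
have := dominated_bound dom q0 x1 x2 hd.
rewrite boxcoxK ?divr_gt0 // beE.
have alq : boxcox q x <= x `^ q / q.
  by rewrite /boxcox gt_eqF // ler_pM2r ?invr_gt0 // gerBl.
have xE : x = x `^ (1 - q) * x `^ q.
  by rewrite -powRD ?subrK ?powRr1 ?gt_eqF ?implybT // ltW.
have xq0 : 0 < x `^ q by exact: powR_gt0.
move: kq kql al0 al'0 be'0 hk alq {hd l1 l2 h0 beE}.
move: (boxcox q 2) (boxcox q x) (boxcox p x) (boxcox p (2 * x)).
move=> kp al al' be' kq kql al0 al'0 be'0 hk alq bound.
have T0 : 0 < T by exact: powR_gt0.
clearbody T.
have Tk : 0 < T - k by rewrite subr_gt0.
have be_ub : kp + T * al <= (T + 1) * al by lra.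
have be0 : 0 < kp + T * al by rewrite addr_gt0 // mulr_gt0.
have step1 : (x / 4) * ((T - k) * (al * al')) ^+ 2 <=
    8 * al * ((T + 1) * al) * (al + (T + 1) * al) * ((1 + k) * al') ^+ 2.
  apply: (@le_trans _ _ ((x / 2 - 1) * (al' * (kp + T * al) - be' * al) ^+ 2)).
    apply: ler_pM; rewrite ?sqr_ge0 //; [lra | lra |].
    have h1 : be' * al <= k * al' * al by rewrite ler_pM2r.
    have h2 := mulr_gt0 al'0 kq; have h3 := mulr_gt0 Tk (mulr_gt0 al0 al'0).
    by rewrite ler_pXn2r ?nnegrE //; lra.
  apply: le_trans bound _.
  have e1 : 0 <= al + (kp + T * al) by lra.
  apply: ler_pM; rewrite ?sqr_ge0 //.
  - by rewrite !mulr_ge0 // ltW.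
  - apply: ler_pM => //; [by rewrite !mulr_ge0 // ltW | | lra].
    by rewrite ler_pM2l // mulr_gt0.
  - have h1 := mulr_gt0 k0 al'0.
    by rewrite ler_pXn2r ?nnegrE //; lra.
have step2 : x * (T - k) ^+ 2 <= 4 * C * al.
  have w0 : 0 < (al * al') ^+ 2 / 4 by rewrite divr_gt0 // exprn_gt0 // mulr_gt0.
  rewrite -(ler_pM2r w0); move: step1; rewrite /C; lra.
have C0 : 0 < C.
  by rewrite /C !mulr_gt0 ?exprn_gt0 //; lra.
have step3 : x `^ (1 - q) * (T - k) ^+ 2 <= 4 * C / q.
  rewrite -(ler_pM2r xq0) mulrAC -xE.
  apply: le_trans step2 _.
  have -> : 4 * C / q * x `^ q = 4 * C * (x `^ q / q) by ring.
  by rewrite ler_pM2l // mulr_gt0.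
move: step3; rewrite -ler_pdivlMr ?exprn_gt0 //.
by rewrite leNgt => /negP; apply; apply: lt_le_trans hM; rewrite ltrDl.
Unshelve. all: by end_near. Qed.

(** The last quantity is the scalar mean of 1 and x. For p > 0 it is at least 2^(-1/p) x, while f_p
    x = O(x^p), and p < 1/2 is exactly 2 s < r for s = p, r = 1. *)
Lemma boxcox_growth p q : 0 <= p -> p < 2^-1 -> p < q ->
  exists s r k, [/\ 0 < s, s < q, 2 * s < r, 0 < k &
    \forall x \near +oo, boxcox p x <= x `^ s / s /\
      k * x `^ r <= invboxcox p (boxcox p x / 2)].
Proof.
move=> p0 ph pq; have q0 : 0 < q by exact: le_lt_trans pq.
move: p0; rewrite le_eqVlt => /predU1P[pz|p0].
  rewrite -{}pz; exists (Num.min 8^-1 (q / 2)), 2^-1, 1.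
  (* For p = 0 the mean is x^(1/2) and ln x = O(x^s) for any s > 0; 1/8 gives 2 s < 1/2, and q/2
     gives s < q. *)
  set s := Num.min _ _.
  have s0 : 0 < s by rewrite lt_min; apply/andP; split; lra.
  have s8 : s <= 8^-1 by rewrite ge_min lexx.
  have sq : s <= q / 2 by rewrite ge_min lexx orbT.
  split => //; [lra | lra |].
  near=> x.
  have x1 : 1 < x by [].
  have x0 : 0 < x by exact: lt_trans x1.
  split.
    apply: (@le_trans _ _ (boxcox s x)).
      by rewrite ltW // boxcox_lt_exponent // gt_eqF.
    by rewrite /boxcox gt_eqF // ler_pM2r ?invr_gt0 // gerBl.
  by rewrite /invboxcox /boxcox eqxx mul1r powR_expR // mulrC.
exists p, 1, (2^-1 `^ p^-1); split => //; [lra |].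
near=> x.
have x0 : 0 < x by [].
split.
  by rewrite /boxcox gt_eqF // ler_pM2r ?invr_gt0 // gerBl.
rewrite /invboxcox gt_eqF // (powRr1 (ltW x0)).
have -> : 1 + p * (boxcox p x / 2) = (1 + (1 + p * boxcox p x)) / 2 by field.
rewrite boxcox_affine //.
have xE : x = (x `^ p) `^ p^-1 by rewrite -powRrM mulfV ?gt_eqF // powRr1 // ltW.
rewrite {1}xE -powRM ?powR_ge0 //.
have xp := powR_ge0 x p.
have ip : 0 <= p^-1 by rewrite invr_ge0 ltW.
by apply: (ge0_ler_powR ip); rewrite ?nnegrE; lra.
Unshelve. all: by end_near. Qed.

(** Apply [dominated_bound] to a = 2, b = x, d = f_p(x)/2. As be' = O(x^s) is negligible against be,
    the factor be^2 cancels and leaves W = O(be'^2) = O(x^(2 s)), whereas W grows at least like x^r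
    with r > 2 s. *)
Lemma dominated_ge_half p q : dominated p q -> p < q -> 0 <= p -> 2^-1 <= p.
Proof.
move=> dom pq p0; rewrite leNgt; apply/negP => ph.
have q0 : 0 < q by exact: le_lt_trans pq.
have [s [r [k [s0 sq sr k0 gnear]]]] := boxcox_growth p0 ph pq.
have two1 : (1 : R) < 2 by lra.
have al0 := boxcox_gt0 q two1; have al'0 := boxcox_gt0 p two1.
set al := boxcox q 2 in al0; have eal : boxcox q 2 = al by [].
set al' := boxcox p 2 in al'0; have eal' : boxcox p 2 = al' by [].
clearbody al al'.
near (pinfty_nbhs R) => x.
have x2 : 2 < x by [].
have x1 : 1 < x by lra.
have x0 : 0 < x by lra.
have [g1 g2] : boxcox p x <= x `^ s / s /\
      k * x `^ r <= invboxcox p (boxcox p x / 2) by near: x.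
(* The thresholds serve in turn for be >= x^q / (2 q), for be' al <= al' be / 2, for W >= 2, and for
   the final contradiction. *)
have n1 : 2 <= x `^ q by near: x; exact: near_powR_ge.
have n2 : 4 * q * al / (s * al') <= x `^ (q - s).
  by near: x; apply: near_powR_ge; rewrite subr_gt0.
have n3 : 2 / k <= x `^ r by near: x; apply: near_powR_ge; lra.
have n4 : 512 * al / (s ^+ 2 * k * al' ^+ 2) + 1 <= x `^ (r - 2 * s).
  by near: x; apply: near_powR_ge; rewrite subr_gt0.
have l1 : al' < boxcox p x by rewrite -eal' boxcox_ltW.
have l2 : al < boxcox q x by rewrite -eal boxcox_ltW.
have be'0 := boxcox_gt0 p x1.
have be0 := boxcox_gt0 q x1.
have hd : 0 <= boxcox p x / 2 < (boxcox p 2 + boxcox p x) / 2.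
  rewrite eal'.
  rewrite divr_ge0 ?ltW //=.
  by rewrite ltr_pM2r // ltrDr.
have := dominated_bound dom q0 two1 x1 hd; rewrite eal eal'.
have be_lb : x `^ q / (2 * q) <= boxcox q x.
  rewrite /boxcox gt_eqF // invfM mulrA ler_pM2r ?invr_gt0 //; lra.
have eq1 : x `^ q = x `^ (q - s) * x `^ s.
  by rewrite -powRD ?subrK // gt_eqF ?implybT.
have eq2 : x `^ r = x `^ (r - 2 * s) * (x `^ s) ^+ 2.
  rewrite -powR_mulrn ?powR_ge0 // -powRrM -powRD ?[s * _]mulrC ?subrK //.
  by rewrite (lt0r_neq0 x0) implybT.
have xs0 : 0 < x `^ s by exact: powR_gt0.
move: be0 be'0 g1 g2 n2 n4 l1 l2 be_lb xs0 eq1 eq2 {hd}.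
move: (boxcox q x) (boxcox p x) (invboxcox p _).
move: (x `^ s) (x `^ (q - s)) (x `^ (r - 2 * s)) => X Y Z.
move=> be be' W be0 be'0 g1 g2 n2 n4 l1 l2 be_lb X0 eq1 eq2 bound.
have W2 : 2 <= W.
  by apply: le_trans g2; rewrite mulrC -ler_pdivrMr.
have half : be' * al <= al' * be / 2.
  have h1 : be' * al <= X / s * al by rewrite ler_pM2r.
  have h2 : X / s * al <= al' / 2 * (x `^ q / (2 * q)).
    rewrite eq1.
    have c0 : 0 < al' * X / (4 * q) by rewrite divr_gt0 ?mulr_gt0.
    have := n2; rewrite -(ler_pM2r c0).
    have -> : 4 * q * al / (s * al') * (al' * X / (4 * q)) = X / s * al.
      by field; rewrite !gt_eqF.
    move=> h; apply: le_trans h _; rewrite le_eqVlt; apply/orP; left; apply/eqP.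
    by field; rewrite gt_eqF.
  have h3 : al' / 2 * (x `^ q / (2 * q)) <= al' / 2 * be.
    by rewrite ler_pM2l // divr_gt0.
  by apply: le_trans h1 (le_trans h2 (le_trans h3 _)); rewrite mulrAC.
have step1 : (W / 2) * (al' * be / 2) ^+ 2 <= 8 * al * be * (2 * be) * (2 * be') ^+ 2.
  apply: (@le_trans _ _ ((W - 1) * (al' * be - be' * al) ^+ 2)).
    have ab0 : 0 < al' * be by exact: mulr_gt0.
    apply: ler_pM; rewrite ?sqr_ge0 //; [lra | lra |].
    rewrite ler_pXn2r ?nnegrE //; lra.
  apply: le_trans bound _.
  apply: ler_pM; rewrite ?sqr_ge0 //.
  - by rewrite !mulr_ge0 ?addr_ge0 // ltW.
  - by rewrite ler_pM2l ?mulr_gt0 //; lra.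
  - by rewrite ler_pXn2r ?nnegrE //; lra.
have step2 : W * al' ^+ 2 <= 512 * al * be' ^+ 2.
  have c0 : 0 < be ^+ 2 / 8 by rewrite divr_gt0 ?exprn_gt0.
  by rewrite -(ler_pM2r c0); move: step1; lra.
have step3 : k * (Z * X ^+ 2) * al' ^+ 2 <= 512 * al * (X / s) ^+ 2.
  apply: (@le_trans _ _ (W * al' ^+ 2)).
    by rewrite ler_pM2r ?exprn_gt0 // -eq2.
  apply: le_trans step2 _.
  have c1 : 0 <= 512 * al by exact: mulr_ge0 (ler0n _ _) (ltW al0).
  have b0 := ltW be'0; have g0 := le_trans b0 g1.
  by apply: (ler_wpM2l c1); rewrite !expr2 (ler_pM b0 b0 g1 g1).
have : Z <= 512 * al / (s ^+ 2 * k * al' ^+ 2).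
  rewrite ler_pdivlMr ?mulr_gt0 ?exprn_gt0 //.
  have c0 : 0 < X ^+ 2 / s ^+ 2 by rewrite divr_gt0 ?exprn_gt0.
  rewrite -(ler_pM2r c0).
  have -> : Z * (s ^+ 2 * k * al' ^+ 2) * (X ^+ 2 / s ^+ 2) =
    k * (Z * X ^+ 2) * al' ^+ 2 by field; rewrite gt_eqF.
  by apply: le_trans step3 _; rewrite exprMn exprVn.
by rewrite leNgt => /negP; apply; apply: lt_le_trans n4; rewrite ltrDl.
Unshelve. all: by end_near. Qed.

End Asymptotics.

Theorem theorem2p3 (R : realType) (p q : R)
  (hpq : forall A B : 'M[R[i]%C]_2, posdefmx A -> posdefmx B ->
     loewner_le (mxpower_mean p A B) (mxpower_mean q A B)) :
  p = q \/
  (1 <= p /\ p < q) \/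
  (p < q /\ q <= -1) \/
  (p <= -1 /\ 1 <= q) \/
  (2^-1 <= p /\ p < 1 /\ 1 <= q) \/
  (p <= -1 /\ -1 < q /\ q <= - 2^-1).
Proof.
have dom := mean_le_dominated hpq; have domN := mean_le_dominatedN hpq.
have := dominated_scalar dom; rewrite le_eqVlt => /predU1P[->|pq]; first by left.
have npq : - q < - p by rewrite ltrN2.
(* [dom] restricts the positive q and the nonnegative p; [domN] gives the mirrored restrictions on
   negative p and nonpositive q. *)
right; have [q0|q0] := ltP 0 q.
  have q1 := dominated_ge1 dom pq q0.
  have [p0|p0] := leP 0 p.
    have ph := dominated_ge_half dom pq p0.
    have [p1|p1] := leP 1 p; first by left.
    by right; right; right; left.
  have := dominated_ge1 domN npq; rewrite oppr_gt0 => /(_ p0).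
  by rewrite lerNr => p1; right; right; left.
have p0 : p < 0 by exact: lt_le_trans q0.
have := dominated_ge1 domN npq; rewrite oppr_gt0 => /(_ p0); rewrite lerNr => p1.
have := dominated_ge_half domN npq; rewrite oppr_ge0 => /(_ q0); rewrite lerNr => qh.
have [q1|q1] := leP q (- 1); first by right; left.
by right; right; right; right.
Qed.
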